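(* There is an absolute constant $C>0$ such that for every finite field $F_q$ of odd characteristic and all functions $f_1,f_2:F_q\to\mathbb{C}$, $$\Big\|\mathcal{A}(f_1,f_2)-\mathbb{E}[f_1]\,\mathbb{E}[f_2]\Big\|_2\leq C\,q^{-1/4}\,\|f_1\|_2\,\|f_2\|_2,$$ where $\mathcal{A}(f_1,f_2)(x)=\frac1q\sum_{y\in F_q}f_1(x+y)f_2(x+y^2)$.
   Context: For $f:F_q\to\mathbb{C}$, $\mathbb{E}[f]=\frac1q\sum_{x\in F_q}f(x)$ and $\|f\|_r=\big(\frac1q\sum_{x\in F_q}|f(x)|^r\big)^{1/r}$. The difference $\mathcal{A}(f_1,f_2)-\mathbb{E}[f_1]\mathbb{E}[f_2]$ denotes the function $x\mapsto \mathcal{A}(f_1,f_2)(x)-\mathbb{E}[f_1]\mathbb{E}[f_2]$. *)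

(* Defs.v *)
From HB Require Import structures.
From mathcomp Require Import all_boot all_order all_algebra.
From mathcomp Require Import complex.
From mathcomp Require Import Rstruct.
From Stdlib Require Import Rdefinitions.
Set Implicit Arguments. Unset Strict Implicit. Unset Printing Implicit Defensive.
Import Order.TTheory GRing.Theory Num.Theory.
Local Open Scope ring_scope.

Notation CC := (complex R).

(* modulus |z| = sqrt(Re z^2 + Im z^2), a real number
   (equal to the library norm: `|z| = (cabs z)%:C, lemma normc_def) *)
Definition cabs (z : CC) : R := Num.sqrt (complex.Re z ^+ 2 + complex.Im z ^+ 2).

Section Defs.
Variable F : finFieldType.

Definition expect (f : F -> CC) : CC :=
  (#|F|%:R)^-1 * \sum_(x : F) f x.

Definition L2norm (f : F -> CC) : R :=
  Num.sqrt ((#|F|%:R)^-1 * \sum_(x : F) (cabs (f x)) ^+ 2).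

Definition Aop (f1 f2 : F -> CC) (x : F) : CC :=
  (#|F|%:R)^-1 * \sum_(y : F) f1 (x + y) * f2 (x + y ^+ 2).
End Defs.

(* Main.v *)
Require Import Defs.
From HB Require Import structures.
From mathcomp Require Import all_boot all_order all_algebra.
From mathcomp Require Import complex.
From mathcomp Require Import Rstruct.
From Stdlib Require Import Rdefinitions.
From mathcomp Require Import ring zify.
Import Order.TTheory GRing.Theory Num.Theory.
Local Open Scope ring_scope.
Set Implicit Arguments.
Unset Strict Implicit.

(* Subtracting its mean from f2, we may assume E f2 = 0. Let g be this new f2
   and P(u,x) = x + (u-x)^2. Opening the square, the L2 norm to bound is a form
   sum f1(u) conj(f1(v)) K(u,v) with
   K(u,v) = sum_x g(P(u,x)) conj(g(P(v,x))), so by Cauchy-Schwarz it is enough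
   to prove sum |K|^2 = O(q |g|_2^4).  The left side counts the "rectangles"
     p1 = P(u,x), p2 = P(u,x'), p3 = P(v,x), p4 = P(v,x')
   with weight g(p1) g(p4) conj(g(p2) g(p3)).  For u <> v, the rectangles with
   given corners correspond to the nonzero roots t = 1/(u-v) of a quadratic
   polynomial. Grouping the corners as (p1,p4) and (p2,p3), and with
   X = p1+p4, m = p1-p4, Y = p2+p3, n = p2-p3, its discriminant factors as
     (X - Y) (X' - Y')  with  X' = X + 2m^2, Y' = Y + 2n^2.
   So up to degenerate cases the number of rectangles is 1 + chi(X-Y) chi(X'-Y'),
   chi being the quadratic character: the constant 1 disappears because g has
   mean zero, and the rest is a tensor product of two Paley matrices
   chi(X-Y), of operator norm at most sqrt q each. *)

(** * The quadratic character *)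

Section QuadraticCharacter.
Variable F : finFieldType.
Hypothesis F_odd : 2%N \notin [pchar F].

Lemma two_neq0 : 2%:R != 0 :> F.
Proof. by apply: contra F_odd => /eqP h; rewrite inE /= h eqxx. Qed.

Definition nsqrt (d : F) : nat := #|[pred y : F | y ^+ 2 == d]|.

(** The quadratic character with value 0 at 0, encoded through root counts: its mean and the number
    of roots of a quadratic then come from counting alone. *)
Definition qchar (d : F) : int := (nsqrt d)%:Z - 1.

Lemma nsqrt_sqr (y : F) : nsqrt (y ^+ 2) = (if y == 0 then 1%N else 2%N).
Proof.
rewrite /nsqrt (eq_card (B := pred2 y (- y))) => [|z]; last first.
  by rewrite !inE eqf_sqr.
rewrite card2; have [->|y0] := eqVneq y 0; first by rewrite oppr0 eqxx.
suff -> : y != - y by [].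
by rewrite -subr_eq0 opprK -mulr2n -mulr_natr mulf_neq0 ?two_neq0.
Qed.

Lemma nsqrtP (d : F) : (exists y, d = y ^+ 2) \/ nsqrt d = 0%N.
Proof.
case: (pickP [pred y : F | y ^+ 2 == d]) => [y /eqP <-|no]; first by left; exists y.
by right; apply: eq_card0 => y; exact: no.
Qed.

Lemma nsqrt_le2 (d : F) : (nsqrt d <= 2)%nat.
Proof. by case: (nsqrtP d) => [[y ->]|->] //; rewrite nsqrt_sqr; case: ifP. Qed.

Lemma nsqrt0 : nsqrt 0 = 1%N.
Proof. by have := nsqrt_sqr 0; rewrite expr0n eqxx. Qed.

Lemma qchar0 : qchar 0 = 0.
Proof. by rewrite /qchar nsqrt0. Qed.

Lemma qchar_sqr (y : F) : y != 0 -> qchar (y ^+ 2) = 1.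
Proof. by move=> /negPf y0; rewrite /qchar nsqrt_sqr y0. Qed.

Lemma qchar_mul_sqr (y c : F) : y != 0 -> qchar (y ^+ 2 * c) = qchar c.
Proof.
move=> y0; congr (_%:Z - 1); rewrite /nsqrt -!sum1_card.
rewrite (reindex_inj (mulfI y0)) /=; apply: eq_bigl => z.
by rewrite !inE exprMn (inj_eq (mulfI _)) // expf_neq0.
Qed.

(** Each element of [F] is a square root of exactly one [d], so the root counts add up to [#|F|]. *)
Lemma sum_qchar : \sum_(d : F) qchar d = 0.
Proof.
rewrite big_split /= sumr_const /= mulNrn.
have -> : #|F| = (\sum_(d : F) nsqrt d)%nat.
  rewrite -sum1_card (partition_big (fun y : F => y ^+ 2) predT) //=.
  by apply: eq_bigr => d _; rewrite /nsqrt -sum1_card; apply: eq_bigl => y; rewrite inE.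
by rewrite natr_sum -sumrB big1 // => d _; rewrite natz subrr.
Qed.

(* For a nonsquare [a], each [qchar c + qchar (a * c)] is nonpositive, while
   their sum over [c] vanishes; hence all of them vanish. *)
Lemma qchar_nonsqr (a c : F) : nsqrt a = 0%N -> qchar (a * c) = - qchar c.
Proof.
move=> na; have a0 : a != 0.
  by apply/eqP => a0; move: na; rewrite a0 nsqrt0.
have le0 d : 0 <= - (qchar d + qchar (a * d)).
  case: (nsqrtP d) => [[y ->]|nd].
    have [->|y0] := eqVneq y 0; first by rewrite expr0n mulr0 qchar0.
    by rewrite mulrC qchar_mul_sqr // qchar_sqr // /qchar na.
  rewrite /qchar nd oppr_ge0 sub0r addrA addrC.
  by have := nsqrt_le2 (a * d); case: (nsqrt _) => [|[|[|]]].
have : \sum_(d : F) - (qchar d + qchar (a * d)) == 0.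
  rewrite sumrN big_split /= sum_qchar.
  by have := sum_qchar; rewrite (reindex_inj (mulfI a0)) /= => ->.
rewrite psumr_eq0 // => /allP /(_ c (mem_index_enum c)).
by rewrite /= oppr_eq0 addrC addr_eq0 => /eqP.
Qed.

Lemma qcharM (a b : F) : qchar (a * b) = qchar a * qchar b.
Proof.
case: (nsqrtP a) => [[y ->]|na].
  have [->|y0] := eqVneq y 0; first by rewrite expr0n mul0r qchar0 mul0r.
  by rewrite qchar_mul_sqr // qchar_sqr // mul1r.
by rewrite qchar_nonsqr // {2}/qchar na sub0r mulN1r.
Qed.

Lemma qchar_sqr1 (a : F) : qchar a * qchar a = (a != 0)%:R.
Proof.
rewrite -qcharM -expr2; have [->|a0] := eqVneq a 0.
  by rewrite expr0n qchar0.
by rewrite qchar_sqr.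
Qed.

Lemma sum_qchar_sqr : \sum_(a : F) qchar a * qchar a = #|F|%:R - 1.
Proof.
rewrite (bigD1 0) //= qchar0 mul0r add0r.
rewrite (eq_bigr (fun=> 1)) => [|a a0]; last by rewrite qchar_sqr1 a0.
apply/eqP; rewrite eq_sym subr_eq -[#|F|]sum1_card natr_sum (bigD1 0) //= addrC.
by apply/eqP; congr (_ + _); apply: eq_bigr.
Qed.

(** For [a != 0], [a * (a + c)] is the square [a ^+ 2] times [1 + c / a], which takes every value
    but 1 once; since [qchar] sums to zero, only minus its value at 1 remains. *)
Lemma sum_qchar_shift (c : F) : c != 0 -> \sum_(a : F) qchar a * qchar (a + c) = -1.
Proof.
move=> c0; rewrite (bigD1 0) //= qchar0 mul0r add0r.
have sum1 : \sum_(z : F | z != 1) qchar z = -1.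
  apply/eqP; rewrite -addr_eq0 addrC; apply/eqP.
  have q1 : qchar 1 = 1 by rewrite -[RHS](qchar_sqr (oner_neq0 F)) expr1n.
  by rewrite -[RHS]sum_qchar [RHS](bigD1 1) //= q1.
rewrite -sum1.
rewrite [RHS](reindex_onto (fun a => 1 + c / a) (fun z => c / (z - 1))) /=; last first.
  move=> z z1; have z1' : z - 1 != 0 by rewrite subr_eq0.
  by field; rewrite c0 z1'.
have neq1 (a : F) : (1 + c / a != 1) = (a != 0).
  by rewrite -subr_eq0 addrAC subrr add0r mulf_eq0 (negPf c0) /= invr_eq0.
apply: eq_big => [a|a a0].
  rewrite neq1; have [//|a0] := eqVneq a 0; apply/esym/eqP; rewrite [1 + _]addrC addrK.
  by field; rewrite a0.
rewrite -qcharM; have -> : a * (a + c) = a ^+ 2 * (1 + c / a) by field.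
by rewrite qchar_mul_sqr.
Qed.

(** The Gram matrix of the Paley matrix is q I - J, with J all ones; this yields the operator
    norm. *)
Lemma qchar_orth (y z : F) :
  \sum_(x : F) qchar (x - y) * qchar (x - z) = #|F|%:R * (y == z)%:R - 1.
Proof.
rewrite (reindex_inj (addIr y)) /=.
have [<-|yz] := eqVneq y z.
  rewrite mulr1 -sum_qchar_sqr.
  by apply: eq_bigr => x _; rewrite addrK.
rewrite mulr0 sub0r -(@sum_qchar_shift (y - z)) ?subr_eq0 //.
by apply: eq_bigr => x _; rewrite addrK addrA.
Qed.

(** Completing the square: [t] is a root exactly when [2%:R * a * t + b] is a square root of the
    discriminant. *)
Lemma card_quadratic_roots (a b c : F) : a != 0 ->
  #|[pred t : F | a * t ^+ 2 + b * t + c == 0]|%:Z = 1 + qchar (b ^+ 2 - 4%:R * a * c).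
Proof.
move=> a0; rewrite /qchar addrC subrK; congr (_%:Z).
have a20 : 2%:R * a != 0 by rewrite mulf_neq0 // two_neq0.
have inj : injective (fun t => 2%:R * a * t + b) by move=> s t /addIr /(mulfI a20).
rewrite /nsqrt -!sum1_card [RHS](reindex_inj inj) /=.
apply: eq_bigl => t; rewrite !inE -subr_eq0 -[RHS]subr_eq0 subr0.
have -> : (2%:R * a * t + b) ^+ 2 - (b ^+ 2 - 4%:R * a * c)
  = (2%:R * (2%:R * a)) * (a * t ^+ 2 + b * t + c) by ring.
by rewrite mulf_eq0 mulf_eq0 (negPf two_neq0) (negPf a20).
Qed.

Lemma card_quadratic_roots_le2 (a b c : F) : a != 0 ->
  leq #|[pred t : F | a * t ^+ 2 + b * t + c == 0]| 2%N.
Proof.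
move=> a0; have := card_quadratic_roots b c a0.
by rewrite /qchar addrC subrK => -[->]; exact: nsqrt_le2.
Qed.

End QuadraticCharacter.

(** * Inequalities and the Paley matrix *)

Section SumInequalities.
Variable C : numClosedFieldType.

(** The triangle inequality reduces to moduli, where Lagrange's identity writes twice the deficit as
    a double sum of real squares. *)
Lemma CauchySchwarz_sum (I : finType) (P : pred I) (f g : I -> C) :
  `|\sum_(i | P i) f i * g i| ^+ 2
    <= (\sum_(i | P i) `|f i| ^+ 2) * (\sum_(i | P i) `|g i| ^+ 2).
Proof.
pose A := \sum_(i | P i) `|f i| ^+ 2; pose B := \sum_(i | P i) `|g i| ^+ 2.
pose M := \sum_(i | P i) `|f i| * `|g i|.
have le_M : `|\sum_(i | P i) f i * g i| <= M.
  by apply: le_trans (ler_norm_sum _ _ _) _; under eq_bigr do rewrite normrM.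
apply: (@le_trans _ _ (M ^+ 2)).
  by rewrite ler_pXn2r // nnegrE ?sumr_ge0 // => i _; rewrite mulr_ge0.
rewrite -subr_ge0 -(@pmulr_rge0 _ 2%:R) ?ltr0n //.
have -> : 2%:R * (A * B - M ^+ 2)
  = \sum_(i | P i) \sum_(j | P j) (`|f i| * `|g j| - `|f j| * `|g i|) ^+ 2.
  have E i j : (`|f i| * `|g j| - `|f j| * `|g i|) ^+ 2
      = `|f i| ^+ 2 * `|g j| ^+ 2 + `|g i| ^+ 2 * `|f j| ^+ 2
        - 2%:R * (`|f i| * `|g i|) * (`|f j| * `|g j|) by ring.
  under eq_bigr => i _ do under eq_bigr => j _ do rewrite E.
  under eq_bigr => i _ do rewrite sumrB big_split /= -!mulr_sumr.
  rewrite sumrB big_split /= -!mulr_suml -mulr_sumr -/A -/B -/M.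
  by ring.
apply: sumr_ge0 => i _; apply: sumr_ge0 => j _.
by rewrite real_exprn_even_ge0 // realB // realM // normr_real.
Qed.

Lemma norm_sum_sqr_le (I : finType) (P : pred I) (f : I -> C) :
  `|\sum_(i | P i) f i| ^+ 2 <= #|P|%:R * \sum_(i | P i) `|f i| ^+ 2.
Proof.
have := CauchySchwarz_sum P (fun=> 1) f.
under eq_bigr do rewrite mul1r.
by under [X in X * _]eq_bigr do rewrite normr1 expr1n; rewrite sumr_const.
Qed.

Lemma mul_norm_le (a b : C) : `|a| * `|b| <= (`|a| ^+ 2 + `|b| ^+ 2) / 2%:R.
Proof.
rewrite ler_pdivlMr ?ltr0n // -subr_ge0.
rewrite (_ : _ - _ = (`|a| - `|b|) ^+ 2); last by ring.
by rewrite real_exprn_even_ge0 // realB // normr_real.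
Qed.

(** AM-GM on each product splits the form into two halves, one controlled by the row sums and the
    other by the column sums. *)
Lemma Schur_test (I : finType) (k : I -> I -> nat) (n : nat) (f : I -> C) :
  (forall i, (\sum_j k i j <= n)%nat) -> (forall j, (\sum_i k i j <= n)%nat) ->
  \sum_i \sum_j (k i j)%:R * (`|f i| * `|f j|) <= n%:R * \sum_i `|f i| ^+ 2.
Proof.
move=> row col.
apply: (@le_trans _ _ (\sum_i \sum_j
    ((k i j)%:R * `|f i| ^+ 2 / 2%:R + (k i j)%:R * `|f j| ^+ 2 / 2%:R))).
  apply: ler_sum => i _; apply: ler_sum => j _.
  by rewrite -mulrDl -mulrDr -mulrA ler_wpM2l ?ler0n // mul_norm_le.
under eq_bigr do rewrite big_split /=.
rewrite big_split /= [X in _ + X]exchange_big /= -big_split mulr_sumr /=.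
apply: ler_sum => i _; rewrite -!mulr_suml -!natr_sum -mulrDl -mulrDl.
rewrite ler_pdivrMr ?ltr0n // mulrAC ler_wpM2r ?exprn_ge0 // mulr_natr mulr2n.
by apply: lerD; rewrite ler_nat.
Qed.

End SumInequalities.

Lemma sum_pair (V : nmodType) (I J : finType) (f : I * J -> V) :
  \sum_p f p = \sum_i \sum_j f (i, j).
Proof. by rewrite pair_bigA; apply: eq_bigr => -[]. Qed.

Section PaleyMatrix.
Variables (C : numClosedFieldType) (F : finFieldType).
Hypothesis F_odd : 2%N \notin [pchar F].

(** Expanding the squares and using orthogonality gives an exact value: the right side minus the
    squared modulus of the sum of [f]. *)
Lemma Paley_bound (f : F -> C) :
  \sum_x `|\sum_y (qchar (x - y))%:~R * f y| ^+ 2 <= #|F|%:R * \sum_y `|f y| ^+ 2.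
Proof.
suff -> : \sum_x `|\sum_y (qchar (x - y))%:~R * f y| ^+ 2
    = #|F|%:R * (\sum_y `|f y| ^+ 2) - `|\sum_y f y| ^+ 2.
  by rewrite gerBl exprn_ge0.
transitivity (\sum_y \sum_z f y * (f z)^* *
    (\sum_x qchar (x - y) * qchar (x - z))%:~R).
  under [RHS]eq_bigr => y _ do under eq_bigr => z _ do rewrite rmorph_sum mulr_sumr.
  under [RHS]eq_bigr => y _ do rewrite exchange_big /=.
  rewrite [RHS]exchange_big /=; apply: eq_bigr => x _.
  rewrite normCK rmorph_sum mulr_suml; apply: eq_bigr => y _.
  rewrite mulr_sumr; apply: eq_bigr => z _.
  by rewrite rmorphM /= rmorph_int intrM; ring.
under eq_bigr => y _ do under eq_bigr => z _ do
  rewrite qchar_orth // rmorphB rmorphM !rmorph_nat rmorph1 mulrBr mulr1.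
under eq_bigr => y _ do rewrite sumrB.
rewrite sumrB; congr (_ - _); last first.
  by rewrite normCK rmorph_sum mulr_suml; apply: eq_bigr => y _; rewrite mulr_sumr.
rewrite mulr_sumr; apply: eq_bigr => y _.
rewrite (bigD1 y) //= eqxx big1 => [|z /negPf zy]; last first.
  by rewrite eq_sym zy !mulr0.
by rewrite addr0 normCK mulr1 mulrC.
Qed.

Lemma Paley_tensor_bound (f : F * F -> C) :
  \sum_(x : F * F) `|\sum_(y : F * F)
      (qchar (x.1 - y.1) * qchar (x.2 - y.2))%:~R * f y| ^+ 2
    <= #|F|%:R ^+ 2 * \sum_(y : F * F) `|f y| ^+ 2.
Proof.
(* The Paley matrix applied in the second coordinate only; the one-variable bound is then used once
   in each coordinate. *)
pose h (u v : F) := \sum_w (qchar (v - w))%:~R * f (u, w).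
rewrite sum_pair exchange_big /=.
apply: (@le_trans _ _ (\sum_v #|F|%:R * \sum_u `|h u v| ^+ 2)).
  apply: ler_sum => v _.
  apply: le_trans (Paley_bound (fun u => h u v)).
  rewrite le_eqVlt; apply/orP; left; apply/eqP; apply: eq_bigr => u _.
  congr (`|_| ^+ 2).
  rewrite sum_pair /=.
  apply: eq_bigr => a _; rewrite mulr_sumr.
  by apply: eq_bigr => b _; rewrite intrM mulrA.
rewrite -mulr_sumr expr2 -mulrA ler_wpM2l // exchange_big /=.
rewrite sum_pair mulr_sumr.
by apply: ler_sum => u _; exact: Paley_bound.
Qed.

Lemma Paley_tensor_form (f : F * F -> C) :
  `|\sum_(x : F * F) \sum_(y : F * F)
      (qchar (x.1 - y.1) * qchar (x.2 - y.2))%:~R * (f x * (f y)^*)|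
    <= #|F|%:R * \sum_(y : F * F) `|f y| ^+ 2.
Proof.
set N := \sum_(y : F * F) `|f y| ^+ 2.
have N0 : 0 <= N by apply: sumr_ge0 => y _; rewrite exprn_ge0.
rewrite -(@ler_pXn2r _ 2) // ?nnegrE ?mulr_ge0 // exprMn.
under eq_bigr => x _ do under eq_bigr => y _ do rewrite mulrCA.
under eq_bigr => x _ do rewrite -mulr_sumr.
apply: le_trans (CauchySchwarz_sum _ _ _) _.
rewrite [N ^+ 2]expr2 mulrCA ler_wpM2l //.
have -> : N = \sum_(y : F * F) `|(f y)^*| ^+ 2.
  by apply: eq_bigr => y _; rewrite norm_conjC.
exact: Paley_tensor_bound.
Qed.

End PaleyMatrix.

(** * Counting rectangles *)

Section Parabola.
Variable F : finFieldType.
Hypothesis F_odd : 2%N \notin [pchar F].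

(** With [u = x + y], the second argument [x + y ^+ 2] of the average becomes [pcurve u x]. *)
Definition pcurve (u x : F) : F := x + (u - x) ^+ 2.

(* Throughout, [a = (p1, p4)] and [b = (p2, p3)]. *)
Definition rect_poly (a b : F * F) (t : F) : F :=
  ((a.1 - b.2) ^+ 2 - (b.1 - a.2) ^+ 2) / 2%:R * t ^+ 2
  - ((a.1 + a.2) - (b.1 + b.2)) * t - ((a.1 - a.2) - (b.1 - b.2)).

Definition rect_count (a b : F * F) : nat :=
  #|[pred t : F | (t != 0) && (rect_poly a b t == 0)]|.

(** For corners p1, ..., p4 and t = 1/(u - v), the corners p1 and p3 determine u + v, and so do p2
    and p4; [rect_poly] vanishes exactly when the two values agree. *)
Lemma sum_rectangles (V : nzRingType) (f : F * F -> F * F -> V) :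
  \sum_(w : (F * F) * (F * F) | w.1.1 != w.1.2)
     f (pcurve w.1.1 w.2.1, pcurve w.1.2 w.2.2) (pcurve w.1.1 w.2.2, pcurve w.1.2 w.2.1)
  = \sum_a \sum_b (rect_count a b)%:R * f a b.
Proof.
have two0 := two_neq0 F_odd.
have -> : \sum_a \sum_b (rect_count a b)%:R * f a b
  = \sum_(z : (F * F) * (F * F) * F | (z.2 != 0) && (rect_poly z.1.1 z.1.2 z.2 == 0))
      f z.1.1 z.1.2.
  rewrite [RHS]big_mkcond [RHS]sum_pair [RHS]sum_pair.
  apply: eq_bigr => a _; apply: eq_bigr => b _.
  rewrite /= -big_mkcond /= mulr_natl -sumr_const.
  by apply: eq_bigl => t; rewrite inE.
(* Recovers u + v from p1, p3 and t: (p1 - p3) t equals u + v - 2x, and p1 + p3 gives the rest. *)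
pose su (z : (F * F) * (F * F) * F) : F := let: (a, b, t) := z in
  a.1 + b.2 + (a.1 - b.2) * t - (((a.1 - b.2) * t) ^+ 2 + (t^-1) ^+ 2) / 2%:R.
pose h (z : (F * F) * (F * F) * F) : (F * F) * (F * F) :=
  let: (a, b, t) := z in
  (((su z + t^-1) / 2%:R, (su z - t^-1) / 2%:R),
   ((su z - (a.1 - b.2) * t) / 2%:R, (su z - (b.1 - a.2) * t) / 2%:R)).
pose h' (w : (F * F) * (F * F)) : (F * F) * (F * F) * F :=
  ((pcurve w.1.1 w.2.1, pcurve w.1.2 w.2.2),
   (pcurve w.1.1 w.2.2, pcurve w.1.2 w.2.1), (w.1.1 - w.1.2)^-1).
have hK w : w.1.1 != w.1.2 -> h (h' w) = w.
  case: w => [[u v] [x y]] /=; rewrite -subr_eq0 => uv.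
  rewrite /h /h' /su /pcurve /= invrK.
  by congr ((_, _), (_, _)); field; rewrite uv two0.
rewrite (reindex_onto h h') //=; apply: eq_big => [|[[a b] t]] /=; last first.
  by case/andP => _ /eqP; rewrite {1}/h' => -[-> -> _].
move=> [[[p1 p4] [p2 p3]] t] /=.
have d_h : (h ((p1, p4), (p2, p3), t)).1.1 - (h ((p1, p4), (p2, p3), t)).1.2 = t^-1.
  by rewrite /h; move: (su _) (t^-1) => s k /=; field.
rewrite -subr_eq0 d_h invr_eq0; have [->//|t0] := eqVneq t 0.
(* The round trip fixes p1, p3 and t but shifts p4 and p2 by half of [rect_poly], so it is the
   identity exactly at the roots. *)
have h'h : h' (h ((p1, p4), (p2, p3), t)) =
  ((p1, p4 - rect_poly (p1, p4) (p2, p3) t / 2%:R),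
   (p2 - rect_poly (p1, p4) (p2, p3) t / 2%:R, p3), t).
  rewrite {1}/h' d_h invrK.
  by congr ((_, _), (_, _), _); rewrite /pcurve /h /su /rect_poly /=; field; rewrite ?t0 ?two0.
rewrite h'h /= -!pair_eqE /= /pair_eq /= !eqxx /= !andbT.
have [->|r0] := eqVneq (rect_poly _ _ _) 0.
  by rewrite mul0r !subr0 !eqxx.
apply/eqP => -[/eqP]; rewrite -subr_eq0 addrAC subrr sub0r oppr_eq0 mulf_eq0 invr_eq0.
by rewrite (negPf r0) (negPf two0).
Qed.

Definition psum (a : F * F) : F := a.1 + a.2.
Definition pdiff (a : F * F) : F := a.1 - a.2.

(* At most two-to-one: it determines p1 + p4 and (p1 - p4)^2. *)
Definition sheared (a : F * F) : F * F := (psum a, psum a + 2%:R * pdiff a ^+ 2).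

(** The degenerate cases. With m and n the two differences, m = n makes t = 0 a root, equal sums
    kill the two higher coefficients, m = -n kills the leading one, and for [a = b] the polynomial
    is zero. *)
Definition rect_error (a b : F * F) : nat :=
  ((pdiff a == pdiff b) + (psum a == psum b) + (pdiff a == pdiff (b.2, b.1))
   + #|F| * (a == b))%nat.

Lemma rect_count_bound (a b : F * F) :
  `|(rect_count a b)%:Z - 1
     - qchar ((sheared a).1 - (sheared b).1) * qchar ((sheared a).2 - (sheared b).2)|
    <= (rect_error a b)%:Z.
Proof.
have two0 := two_neq0 F_odd.
case: a b => [p1 p4] [p2 p3].
rewrite /rect_error -qcharM // /sheared /psum /pdiff /=.
set disc := (_ - _) * _.
set m := p1 - p4; set n := p2 - p3; set X := p1 + p4; set Y := p2 + p3.
have polyE t : rect_poly (p1, p4) (p2, p3) t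
    = (X - Y) * (m + n) / 2%:R * t ^+ 2 - (X - Y) * t - (m - n).
  by rewrite /rect_poly /X /Y /m /n /=; field.
have discE : disc = (X - Y) ^+ 2
     - 4%:R * ((X - Y) * (m + n) / 2%:R) * (- (m - n)).
  by rewrite /disc /X /Y /m /n; field.
have -> : p3 - p2 = - n by rewrite opprB.
rewrite /rect_count.
(* Here the polynomial is the constant -(m - n): it has no root or, when also m = n and hence
   [a = b], all [#|F|.-1] nonzero [t] are roots. *)
have [XY|XY] := eqVneq X Y.
  rewrite discE XY subrr !mul0r mulr0 mul0r expr0n subrr qchar0 // subr0.
  have cnt : #|[pred t : F | (t != 0) && (rect_poly (p1, p4) (p2, p3) t == 0)]|
     = if m == n then #|F|.-1 else 0%N.
    rewrite -subr_eq0; case: ifP => mn.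
      rewrite -(cardC1 (0 : F)); apply: eq_card => t; rewrite !inE polyE XY subrr !mul0r.
      by rewrite subrr sub0r oppr_eq0 mn andbT.
    apply: eq_card0 => t; rewrite !inE polyE XY subrr !mul0r subrr sub0r oppr_eq0 mn.
    by rewrite andbF.
  rewrite cnt; have F0 : (0 < #|F|)%nat by apply/card_gt0P; exists 0.
  case: eqVneq => mn.
    have -> : ((p1, p4) == (p2, p3)) = true.
      have E1 : p1 = p2.
        by apply: (mulfI two0); transitivity (X + m); [rewrite /X /m|rewrite XY mn /Y /n]; ring.
      have E2 : p4 = p3.
        by apply: (mulfI two0); transitivity (X - m); [rewrite /X /m|rewrite XY mn /Y /n]; ring.
      by rewrite E1 E2 eqxx.
    rewrite muln1; case: #|F| F0 => [//|q] _ /=; lia.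
  by rewrite sub0r normrN1 lez_nat add0n.
have XY0 : X - Y != 0 by rewrite subr_eq0.
(* Here the polynomial has degree one, with root (n - m) / (X - Y), which is counted unless m = n;
   the discriminant is a nonzero square. *)
have [mn|mn] := eqVneq m (- n).
  have -> : qchar disc = 1.
    by rewrite discE mn addNr mulr0 !mul0r mulr0 mul0r subr0 qchar_sqr.
  have cnt : #|[pred t : F | (t != 0) && (rect_poly (p1, p4) (p2, p3) t == 0)]|
     = (n != m).
    have E t : (rect_poly (p1, p4) (p2, p3) t == 0) = (t == (n - m) / (X - Y)).
      have -> : rect_poly (p1, p4) (p2, p3) t = (X - Y) * ((n - m) / (X - Y) - t).
        by rewrite polyE {1}mn addNr; field; rewrite two0 XY0.
      by rewrite mulf_eq0 (negPf XY0) subr_eq0 eq_sym.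
    rewrite (eq_card (B := [pred t | (t == (n - m) / (X - Y)) && (n != m)])) => [|t].
      case: (eqVneq n m) => _ /=; last first.
        by rewrite -(card1 ((n - m) / (X - Y))); apply: eq_card => t; rewrite !inE ?andbT.
      by apply: eq_card0 => t; rewrite !inE andbF.
    rewrite !inE E andbC; case: eqVneq => //= ->.
    by rewrite mulf_eq0 invr_eq0 (negPf XY0) orbF subr_eq0.
  by rewrite cnt (eq_sym m n); case: (n == m); rewrite ?add0n ?addn0.
have a0 : (X - Y) * (m + n) / 2%:R != 0.
  by rewrite !mulf_neq0 ?invr_eq0 // addr_eq0.
have := card_quadratic_roots F_odd (- (X - Y)) (- (m - n)) a0.
rewrite sqrrN -discE => E.
(* The constant coefficient is -(m - n), so dropping [t = 0] loses a root exactly when m = n. *)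
have {E} E : (rect_count (p1, p4) (p2, p3) + (m == n))%nat%:Z = 1 + qchar disc.
  rewrite -E; congr (_%:Z).
  rewrite (cardD1 0) addnC inE /=; congr (_ + _)%nat.
    by rewrite expr0n !mulr0 addr0 add0r oppr_eq0 subr_eq0.
  by apply: eq_card => t; rewrite !inE polyE mulNr.
move: E; rewrite /rect_count; case: (m == n); case: (_ == (p2, p3)); lia.
Qed.

End Parabola.

(** * The bilinear estimate *)

Section Quartic.
Variables (C : numClosedFieldType) (F : finFieldType).
Hypothesis F_odd : 2%N \notin [pchar F].

(** Equal sums and equal squared differences leave only a pair and its swap. *)
Lemma card_sheared_fibre (p : F * F) : leq #|[pred a | sheared a == p]| 2%N.
Proof.
have two0 := two_neq0 F_odd.
case: (pickP [pred a | sheared a == p]) => [a /= /eqP <-|no]; last by rewrite eq_card0.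
apply: (@leq_trans #|pred2 a (a.2, a.1)|); last by rewrite card2; case: (_ != _).
apply/subset_leq_card/subsetP => b; rewrite !inE => /eqP [].
rewrite /psum /pdiff => s; rewrite s => /addrI /(mulfI two0) /eqP; rewrite eqf_sqr.
have dbl (c d : F * F) : c.1 + c.2 = d.1 + d.2 -> c.1 - c.2 = d.1 - d.2 -> c = d.
  case: c d => [c1 c2] [d1 d2] /= s' d'.
  congr (_, _); apply: (mulfI two0).
    by transitivity ((c1 + c2) + (c1 - c2)); [|rewrite s' d']; ring.
  by transitivity ((c1 + c2) - (c1 - c2)); [|rewrite s' d']; ring.
case/orP => /eqP d; apply/orP; [left|right]; apply/eqP; apply: dbl => //=.
  by rewrite s addrC.
by rewrite d opprB.
Qed.

(** For each [x] at most one [y] qualifies. This bounds each of the first three terms of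
    [rect_error] by [#|F|] per row. *)
Lemma sum_level_set (h : F * F -> F) (c : F) :
  (forall x, injective (fun y => h (x, y))) ->
  (\sum_a (h a == c) <= #|F|)%nat.
Proof.
move=> inj; rewrite sum_pair -[leqRHS]sum1_card; apply: leq_sum => x _.
case: (pickP (fun y => h (x, y) == c)) => [y /eqP <-|no]; last first.
  by rewrite big1 // => y _; rewrite no.
rewrite (bigD1 y) //= eqxx big1 ?addn0 // => z zy.
by rewrite (inj_eq (inj x)) (negPf zy).
Qed.

Lemma sum_rect_error_row (a : F * F) : leq (\sum_b rect_error a b) (4 * #|F|).
Proof.
rewrite /rect_error !big_split /= -big_distrr /=.
have h1 : leq (\sum_b (pdiff a == pdiff b)) #|F|.
  under eq_bigr do rewrite eq_sym.
  by apply: sum_level_set => x y z /addrI /oppr_inj.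
have h2 : leq (\sum_b (psum a == psum b)) #|F|.
  under eq_bigr do rewrite eq_sym.
  by apply: sum_level_set => x y z /addrI.
have h3 : leq (\sum_b (pdiff a == pdiff (b.2, b.1))) #|F|.
  under eq_bigr do rewrite eq_sym.
  by apply: (sum_level_set (h := fun b => pdiff (b.2, b.1))) => x y z /addIr.
have -> : (\sum_(b : F * F) (a == b) = 1)%nat.
  rewrite (bigD1 a) //= eqxx big1 ?addn0 // => b ba.
  by rewrite eq_sym (negPf ba).
have -> : (4 * #|F| = #|F| + #|F| + #|F| + #|F|)%nat by lia.
by rewrite muln1; exact: (leq_add (leq_add (leq_add h1 h2) h3) (leqnn _)).
Qed.

Lemma rect_error_sym (a b : F * F) : rect_error a b = rect_error b a.
Proof.
rewrite /rect_error (eq_sym (pdiff a) (pdiff b)) (eq_sym (psum a)) (eq_sym a).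
congr (_ + _ + nat_of_bool _ + _)%nat.
by rewrite /pdiff /= -(inj_eq oppr_inj) !opprB eq_sym.
Qed.

Lemma sum_rect_error_col (b : F * F) : leq (\sum_a rect_error a b) (4 * #|F|).
Proof. by under eq_bigr do rewrite rect_error_sym; exact: sum_rect_error_row. Qed.

(** The count is written as 1 + [k] + [e]: mean zero kills the 1, the Schur test bounds the [e] part
    with 4q, and the Paley tensor form bounds the [k] part with 2q. *)
Lemma rect_form_bound (G : F * F -> C) : \sum_a G a = 0 ->
  `|\sum_a \sum_b (rect_count a b)%:R * (G a * (G b)^*)|
    <= 6%:R * #|F|%:R * \sum_a `|G a| ^+ 2.
Proof.
move=> G0.
pose k (a b : F * F) := qchar ((sheared a).1 - (sheared b).1)
  * qchar ((sheared a).2 - (sheared b).2).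
pose e (a b : F * F) := (rect_count a b)%:Z - 1 - k a b.
have -> : \sum_a \sum_b (rect_count a b)%:R * (G a * (G b)^*)
  = \sum_a \sum_b (k a b)%:~R * (G a * (G b)^*)
    + \sum_a \sum_b (e a b)%:~R * (G a * (G b)^*).
  have GG0 : \sum_a \sum_b G a * (G b)^* = 0.
    by rewrite big1 // => a _; rewrite -mulr_sumr -rmorph_sum G0 rmorph0 mulr0.
  rewrite -[LHS]subr0 -[X in _ - X = _]GG0 -sumrB -big_split; apply: eq_bigr => a _ /=.
  rewrite -sumrB -big_split; apply: eq_bigr => b _ /=.
  by rewrite /e !intrB; ring.
have -> : 6%:R * #|F|%:R * (\sum_a `|G a| ^+ 2)
  = 2%:R * #|F|%:R * (\sum_a `|G a| ^+ 2) + (4 * #|F|)%:R * (\sum_a `|G a| ^+ 2).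
  by rewrite natrM; ring.
apply: le_trans (ler_normD _ _) _; apply: lerD; last first.
  apply: le_trans (Schur_test _ sum_rect_error_row sum_rect_error_col).
  apply: le_trans (ler_norm_sum _ _ _) _; apply: ler_sum => a _.
  apply: le_trans (ler_norm_sum _ _ _) _; apply: ler_sum => b _.
  rewrite !normrM norm_conjC ler_wpM2r ?mulr_ge0 //.
  by rewrite -intr_norm -[leRHS]/((rect_error a b)%:Z%:~R) ler_int rect_count_bound.
(* As [k] depends only on the sheared points, [G] may be summed over fibres first; these have at
   most two points, so Cauchy-Schwarz costs a factor 2. *)
pose H p := \sum_(a | sheared a == p) G a.
have -> : \sum_a \sum_b (k a b)%:~R * (G a * (G b)^*)
  = \sum_p \sum_q (qchar (p.1 - q.1) * qchar (p.2 - q.2))%:~R * (H p * (H q)^*).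
  rewrite (partition_big (@sheared F) predT) //=; apply: eq_bigr => p _.
  rewrite exchange_big (partition_big (@sheared F) predT) //=.
  apply: eq_bigr => q _; rewrite exchange_big /H rmorph_sum /= mulr_suml mulr_sumr.
  apply: eq_bigr => a /eqP <-; rewrite !mulr_sumr; apply: eq_bigr => b /eqP <-.
  by [].
apply: le_trans (Paley_tensor_form F_odd H) _.
rewrite [2%:R * _]mulrC -mulrA ler_wpM2l ?ler0n //.
rewrite [X in _ * X](partition_big (@sheared F) predT) //= mulr_sumr.
apply: ler_sum => p _; apply: le_trans (norm_sum_sqr_le _ _) _.
by rewrite ler_wpM2r ?ler_nat ?card_sheared_fibre // sumr_ge0 // => a _; rewrite exprn_ge0.
Qed.

Definition pcurve_corr (g : F -> C) (u v : F) : C :=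
  \sum_x g (pcurve u x) * (g (pcurve v x))^*.

(** Handles u = v, absent from the rectangle count: [pcurve u] is a quadratic polynomial, so at most
    two-to-one. *)
Lemma pcurve_corr_diag (g : F -> C) (u : F) :
  `|pcurve_corr g u u| <= 2%:R * \sum_x `|g x| ^+ 2.
Proof.
rewrite /pcurve_corr; under eq_bigr do rewrite -normCK.
rewrite ger0_norm; last by apply: sumr_ge0 => x _; rewrite exprn_ge0.
rewrite (partition_big (pcurve u) predT) //= mulr_sumr; apply: ler_sum => p _.
rewrite (eq_bigr (fun=> `|g p| ^+ 2)) => [|x /eqP -> //].
rewrite sumr_const -[leLHS]mulr_natl ler_wpM2r ?exprn_ge0 // ler_nat.
have := card_quadratic_roots_le2 F_odd (1 - 2%:R * u) (u ^+ 2 - p) (oner_neq0 F).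
apply: leq_trans; apply/eq_leq/eq_card => x; rewrite [RHS]inE unfold_in /=.
by rewrite -[LHS]subr_eq0 /pcurve; congr (_ == 0); ring.
Qed.

Lemma sum_pcurve_corr (g : F -> C) : \sum_x g x = 0 ->
  \sum_u \sum_v `|pcurve_corr g u v| ^+ 2
    <= 10%:R * #|F|%:R * (\sum_x `|g x| ^+ 2) ^+ 2.
Proof.
move=> g0; set n := \sum_x `|g x| ^+ 2.
have n0 : 0 <= n by apply: sumr_ge0 => x _; rewrite exprn_ge0.
pose G (a : F * F) := g a.1 * g a.2.
have G2 : \sum_a `|G a| ^+ 2 = n ^+ 2.
  rewrite sum_pair [n ^+ 2]expr2 /n mulr_suml; apply: eq_bigr => x _.
  by rewrite mulr_sumr; apply: eq_bigr => y _; rewrite /G normrM exprMn.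
have G0 : \sum_a G a = 0.
  by rewrite sum_pair big1 // => x _; rewrite /G /= -mulr_sumr g0 mulr0.
have offdiag := sum_rectangles F_odd (fun a b => G a * (G b)^*).
rewrite pair_bigA (bigID (fun w : F * F => w.1 == w.2)) /=.
(* The q diagonal terms contribute 4 each and the off-diagonal form contributes 6q, whence 10. *)
have -> : 10%:R * #|F|%:R * n ^+ 2
    = \sum_(u : F) (2%:R * n) ^+ 2 + 6%:R * #|F|%:R * \sum_a `|G a| ^+ 2.
  by rewrite G2 sumr_const -[X in _ = X + _]mulr_natl; ring.
apply: lerD.
  rewrite (reindex_onto (fun u : F => (u, u)) fst) /=; last by case=> u v /= /eqP ->.
  rewrite (eq_bigl predT) => [|u]; last by rewrite !eqxx.
  apply: ler_sum => u _; rewrite ler_pXn2r ?nnegrE ?mulr_ge0 //.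
  exact: pcurve_corr_diag.
set T := \sum_(w | _) _.
have T0 : 0 <= T by apply: sumr_ge0 => w _; rewrite exprn_ge0.
rewrite -(ger0_norm T0); apply: le_trans (rect_form_bound G0).
rewrite -offdiag le_eqVlt; apply/orP; left; apply/eqP; congr `|_|.
rewrite /T [LHS]big_mkcond [RHS]big_mkcond [RHS]sum_pair /=.
apply: eq_bigr => -[u v] _ /=; case: eqP => _ /=; first by rewrite big1.
rewrite normCK sum_pair /pcurve_corr rmorph_sum mulr_suml; apply: eq_bigr => x _.
rewrite mulr_sumr; apply: eq_bigr => y _.
by rewrite /G /= !rmorphM /= conjCK; ring.
Qed.

(** Cauchy-Schwarz over the pairs (u, v) separates [f] from the correlation kernel; squaring the sum
    once more avoids roots. *)
Lemma bilinear_average_bound (f g : F -> C) : \sum_x g x = 0 ->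
  (\sum_x `|\sum_y f (x + y) * g (x + y ^+ 2)| ^+ 2) ^+ 2
    <= 10%:R * #|F|%:R * (\sum_x `|f x| ^+ 2) ^+ 2 * (\sum_x `|g x| ^+ 2) ^+ 2.
Proof.
move=> g0; set T := \sum_x `|\sum_y _| ^+ 2.
have T0 : 0 <= T by apply: sumr_ge0 => x _; rewrite exprn_ge0.
have TE : T = \sum_(w : F * F) (f w.1 * (f w.2)^*) * pcurve_corr g w.1 w.2.
  rewrite sum_pair /=; under [RHS]eq_bigr => u _ do
    under eq_bigr => v _ do rewrite mulr_sumr.
  under [RHS]eq_bigr => u _ do rewrite exchange_big /=.
  rewrite [RHS]exchange_big /=; apply: eq_bigr => x _.
  have -> : \sum_y f (x + y) * g (x + y ^+ 2) = \sum_u f u * g (pcurve u x).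
    rewrite [RHS](reindex_inj (addrI x)) /=; apply: eq_bigr => y _.
    by rewrite /pcurve addrAC subrr add0r.
  rewrite normCK rmorph_sum mulr_suml; apply: eq_bigr => u _.
  rewrite mulr_sumr; apply: eq_bigr => v _.
  by rewrite rmorphM /=; ring.
rewrite -(ger0_norm T0) TE; apply: le_trans (CauchySchwarz_sum _ _ _) _.
have -> : \sum_(w : F * F) `|f w.1 * (f w.2)^*| ^+ 2 = (\sum_x `|f x| ^+ 2) ^+ 2.
  rewrite sum_pair [RHS]expr2 mulr_suml; apply: eq_bigr => u _.
  by rewrite mulr_sumr; apply: eq_bigr => v _; rewrite normrM norm_conjC exprMn.
rewrite sum_pair -mulrA mulrCA ler_wpM2l; last exact: sum_pcurve_corr.
  by [].
by rewrite exprn_ge0 // sumr_ge0 // => x _; rewrite exprn_ge0.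
Qed.

(** The exact loss is q times the squared modulus of the mean. This lets the norm of [f2] replace
    that of its centered version. *)
Lemma variance_le (f : F -> C) :
  \sum_x `|f x - #|F|%:R^-1 * \sum_y f y| ^+ 2 <= \sum_x `|f x| ^+ 2.
Proof.
set c := _ * _.
have qc : \sum_y f y = #|F|%:R * c.
  rewrite /c mulVKf // pnatr_eq0 -lt0n; apply/card_gt0P; by exists 0.
move: c qc => c qc.
have -> : \sum_x `|f x - c| ^+ 2 = \sum_x `|f x| ^+ 2 - #|F|%:R * `|c| ^+ 2.
  transitivity (\sum_x (`|f x| ^+ 2 - f x * c^* - c * (f x)^* + `|c| ^+ 2)).
    by apply: eq_bigr => x _; rewrite !normCK rmorphB; ring.
  rewrite big_split !sumrB /= -mulr_suml -mulr_sumr -rmorph_sum /= qc.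
  by rewrite rmorphM /= rmorph_nat sumr_const -[_ *+ _]mulr_natl normCK; ring.
by rewrite gerBl mulr_ge0 ?exprn_ge0.
Qed.
End Quartic.

(** * Transfer to the normalized real norms *)

Lemma sum_cabsE (F : finFieldType) (f : F -> CC) :
  real_complex R (\sum_x cabs (f x) ^+ 2) = \sum_x `|f x| ^+ 2.
Proof.
rewrite rmorph_sum; apply: eq_bigr => x _.
by rewrite rmorphXn /=; case: (f x) => a b; rewrite normc_def.
Qed.

Lemma L2norm_ge0 (F : finFieldType) (f : F -> CC) : 0 <= L2norm f.
Proof. exact: sqrtr_ge0. Qed.

Lemma L2norm_sqr (F : finFieldType) (f : F -> CC) :
  L2norm f ^+ 2 = #|F|%:R^-1 * \sum_x cabs (f x) ^+ 2.
Proof.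
rewrite sqr_sqrtr // mulr_ge0 ?invr_ge0 ?ler0n // sumr_ge0 // => x _.
by rewrite exprn_ge0 // sqrtr_ge0.
Qed.

(** Fourth powers turn q^(-1/4) into 1/q and remove the square roots from the norms, leaving a
    polynomial inequality in sums of squares. *)
Lemma average_deviation_bound (F : finFieldType) (f1 f2 : F -> CC) :
  2%N \notin [pchar F] ->
  L2norm (fun x => Aop f1 f2 x - expect f1 * expect f2) ^+ 4
    <= 10%:R * #|F|%:R^-1 * (L2norm f1 ^+ 4 * L2norm f2 ^+ 4).
Proof.
move=> F_odd.
set h := fun x : F => _; pose g x := f2 x - expect f2.
have q0 : #|F|%:R != 0 :> CC.
  by rewrite pnatr_eq0 -lt0n; apply/card_gt0P; exists 0.
have qR0 : #|F|%:R != 0 :> R.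
  by rewrite pnatr_eq0 -lt0n; apply/card_gt0P; exists 0.
have g0 : \sum_x g x = 0.
  by rewrite sumrB sumr_const -[_ *+ _]mulr_natl /expect mulVKf // subrr.
(* Subtracting the product of the means amounts to centering [f2], since [f1 (x + y)] averaged over
   [y] gives [expect f1] for every [x]. *)
have hE x : h x = #|F|%:R^-1 * \sum_y f1 (x + y) * g (x + y ^+ 2).
  rewrite /h /Aop /g; under [in RHS]eq_bigr do rewrite mulrBr.
  rewrite sumrB mulrBr -mulr_suml; congr (_ - _); rewrite [RHS]mulrA; congr (_ * _).
  by rewrite {1}/expect (reindex_inj (addrI x)).
pose N (f : F -> CC) : R := \sum_x cabs (f x) ^+ 2.
have N0 f : 0 <= N f by apply: sumr_ge0 => x _; rewrite exprn_ge0 // sqrtr_ge0.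
have bound : (#|F|%:R ^+ 2 * N h) ^+ 2 <= 10%:R * #|F|%:R * N f1 ^+ 2 * N f2 ^+ 2.
  (* The real inequality is embedded in [CC], where the bilinear estimate applies. *)
  rewrite -lecR !(rmorphM, rmorphXn, rmorph_nat) /= !sum_cabsE.
  have -> : #|F|%:R ^+ 2 * \sum_x `|h x| ^+ 2
      = \sum_x `|\sum_y f1 (x + y) * g (x + y ^+ 2)| ^+ 2.
    rewrite mulr_sumr; apply: eq_bigr => x _.
    rewrite hE normrM exprMn mulrA normfV normr_nat -exprMn divff //.
    by rewrite expr1n mul1r.
  apply: le_trans (bilinear_average_bound F_odd f1 g0) _.
  have S0 (f : F -> CC) : 0 <= \sum_x `|f x| ^+ 2.
    by apply: sumr_ge0 => x _; rewrite exprn_ge0.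
  rewrite ler_wpM2l ?mulr_ge0 ?exprn_ge0 ?ler0n //.
  by rewrite ler_pXn2r ?nnegrE //; exact: variance_le.
rewrite !(exprM _ 2 2) !L2norm_sqr -/(N h) -/(N f1) -/(N f2).
have -> : (#|F|%:R^-1 * N h) ^+ 2 = #|F|%:R^-1 ^+ 6 * (#|F|%:R ^+ 2 * N h) ^+ 2.
  by field.
have -> : 10%:R * #|F|%:R^-1 * ((#|F|%:R^-1 * N f1) ^+ 2 * (#|F|%:R^-1 * N f2) ^+ 2)
   = #|F|%:R^-1 ^+ 6 * (10%:R * #|F|%:R * N f1 ^+ 2 * N f2 ^+ 2).
  by field.
by rewrite ler_wpM2l // exprn_ge0 // invr_ge0 ler0n.
Qed.

Theorem theorem1p2 :
  exists C : R, 0 < C /\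
  forall (F : finFieldType), 2%N \notin [pchar F] ->
  forall f1 f2 : F -> CC,
    L2norm (fun x => Aop f1 f2 x - expect f1 * expect f2)
      <= C * (Num.sqrt (Num.sqrt (#|F|%:R : R)))^-1 * L2norm f1 * L2norm f2.
Proof.
(* After taking fourth powers the constant needed is 10, which is at most 2^4 = 16. *)
exists 2%:R; split=> [|F F_odd f1 f2]; first by rewrite ltr0n.
rewrite -(@ler_pXn2r _ 4) ?nnegrE ?mulr_ge0 ?invr_ge0 ?sqrtr_ge0 ?ler0n ?L2norm_ge0 //.
apply: le_trans (average_deviation_bound f1 f2 F_odd) _.
rewrite -[in leRHS]mulrA !exprMn ler_wpM2r ?mulr_ge0 ?exprn_ge0 ?L2norm_ge0 //.
rewrite exprVn (exprM (Num.sqrt _) 2 2) !sqr_sqrtr ?sqrtr_ge0 ?ler0n //.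
by rewrite ler_wpM2r ?invr_ge0 ?ler0n // -natrX ler_nat.
Qed.
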